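(* Let $\mathcal H$ be a complex Hilbert space, let $k$ be a positive integer, and let $\mathbf A=(A_1,\dots,A_m)$ be an $m$-tuple of bounded self-adjoint operators on $\mathcal H$. If $\dim\mathcal H\ge((m+2)k-1)(m+1)^2$, then both $\Lambda_k(\mathbf A)$ and $\operatorname{cl}(\Lambda_k(\mathbf A))$ are star-shaped.
   Context: For an $m$-tuple $\mathbf A=(A_1,\dots,A_m)$ of bounded self-adjoint operators on a complex Hilbert space $\mathcal H$ and a positive integer $k$, the joint rank-$k$ numerical range is $\Lambda_k(\mathbf A)=\{(a_1,\dots,a_m)\in\mathbb R^m:$ there is an orthogonal projection $P$ of rank $k$ on $\mathcal H$ with $PA_jP=a_jP$ for $j=1,\dots,m\}$. $\operatorname{cl}$ denotes closure. A set $S\subseteq\mathbb R^m$ is star-shaped if there is $\mathbf c\in S$ such that for every $\mathbf b\in S$ the line segment joining $\mathbf c$ and $\mathbf b$ lies in $S$. *)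

(* Defs.v *)
From HB Require Import structures.
From mathcomp Require Import all_boot all_order all_algebra.
From mathcomp Require Import complex.
From mathcomp Require Import all_classical all_reals all_analysis.
Set Implicit Arguments. Unset Strict Implicit. Unset Printing Implicit Defensive.
Import Order.TTheory GRing.Theory Num.Theory.
Import numFieldNormedType.Exports.
Local Open Scope ring_scope.
Local Open Scope classical_set_scope.

Section Hilbert.
Variables (R : realType) (V : lmodType R[i]) (ip : V -> V -> R[i]).

Definition hnorm (x : V) : R := Num.sqrt (complex.Re (ip x x)).

Record is_hilbert : Prop := IsHilbert {
  ip_linl : forall (a : R[i]) (x y z : V), ip (a *: x + y) z = a * ip x z + ip y z;
  ip_conj : forall x y : V, ip y x = conjc (ip x y);
  ip_ge0 : forall x : V, complex.Im (ip x x) = 0 /\ 0 <= complex.Re (ip x x);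
  ip_def : forall x : V, ip x x = 0 -> x = 0;
  ip_complete : forall u : nat -> V,
    (forall eps : R, 0 < eps -> exists N : nat, forall p q : nat,
        (N <= p)%N -> (N <= q)%N -> hnorm (u p - u q) < eps) ->
    exists l : V, forall eps : R, 0 < eps -> exists N : nat, forall p : nat,
        (N <= p)%N -> hnorm (u p - l) < eps }.

Definition dim_ge (n : nat) : Prop :=
  exists e : 'I_n -> V, forall c : 'I_n -> R[i],
    \sum_(i < n) c i *: e i = 0 -> forall i, c i = 0.

Definition is_linear_op (T : V -> V) : Prop :=
  forall (a : R[i]) (x y : V), T (a *: x + y) = a *: T x + T y.

Definition is_bounded_op (T : V -> V) : Prop :=
  is_linear_op T /\ exists M : R, forall x, hnorm (T x) <= M * hnorm x.

Definition is_selfadjoint (T : V -> V) : Prop :=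
  forall x y : V, ip (T x) y = ip x (T y).

Definition orthonormal (n : nat) (e : 'I_n -> V) : Prop :=
  forall i j, ip (e i) (e j) = (i == j)%:R.

Definition is_orth_proj_rank (k : nat) (P : V -> V) : Prop :=
  [/\ is_linear_op P, (forall x, P (P x) = P x), is_selfadjoint P &
    exists e : 'I_k -> V, [/\ orthonormal e,
       (forall i, P (e i) = e i) &
       (forall x, exists c : 'I_k -> R[i], P x = \sum_(i < k) c i *: e i)]].

Definition joint_rank_k_nr (m k : nat) (A : 'I_m -> V -> V) : set 'rV[R]_m :=
  [set a | exists P : V -> V, is_orth_proj_rank k P /\
     forall (j : 'I_m) (x : V), P (A j (P x)) = real_complex R (a ord0 j) *: P x].

End Hilbert.

Definition star_shaped (R : realType) (m : nat) (S : set 'rV[R]_m) : Prop :=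
  exists2 c, S c & forall b, S b -> forall t : R, 0 <= t <= 1 ->
    S ((1 - t) *: c + t *: b).

(* Main.v *)
(** Write [K = (m + 2) k].  A point of the rank-[K] range is a star centre of the
    rank-[k] range: if the [A j] compress to [b] on a [k]-space [X], then the
    [K]-space on which they compress to [c] contains a [k]-space orthogonal to
    [X] and to every [A j X], and mixing orthonormal bases of these two
    [k]-spaces with weights [sqrt (1 - t)] and [sqrt t] realises
    [(1 - t) c + t b].

    The rank-[K] range is nonempty: one picks greedily [(m + 1)(K - 1) + 1]
    orthonormal vectors [y r] with [<A j (y r), y s> = 0] for [r <> s].
    Tverberg's theorem splits the joint numerical values of the [y r] into [K]
    blocks whose convex hulls meet, and the vectors
    [\sum_(r in block) sqrt (l r) y r] span a [K]-space on which the [A j] are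
    scalar. *)

Require Import Defs.
From HB Require Import structures.
From mathcomp Require Import all_boot all_order all_algebra.
From mathcomp Require Import complex.
From mathcomp Require Import all_classical all_reals all_analysis.
From mathcomp Require Import ring lra zify.
Import Order.TTheory GRing.Theory Num.Theory.
Import numFieldNormedType.Exports.
Local Open Scope ring_scope.
Local Open Scope classical_set_scope.
Set Implicit Arguments.
Unset Strict Implicit.
Unset Printing Implicit Defensive.

(** * Tverberg's theorem *)

Section Tverberg.
Variable R : realType.
Implicit Types N n : nat.

(** * The Euclidean inner product on row vectors *)

Definition dot N (x y : 'rV[R]_N) : R := (x *m y^T) 0 0.

Lemma dotE N (x y : 'rV[R]_N) : dot x y = \sum_i x 0 i * y 0 i.
Proof. by rewrite /dot mxE; apply: eq_bigr => i _; rewrite mxE. Qed.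

Lemma dotC N (x y : 'rV[R]_N) : dot x y = dot y x.
Proof. by rewrite !dotE; apply: eq_bigr => i _; rewrite mulrC. Qed.

Lemma dotDl N (x y z : 'rV[R]_N) : dot (x + y) z = dot x z + dot y z.
Proof. by rewrite /dot mulmxDl mxE. Qed.

Lemma dotZl N a (x y : 'rV[R]_N) : dot (a *: x) y = a * dot x y.
Proof. by rewrite /dot -scalemxAl mxE. Qed.

Lemma dotDr N (x y z : 'rV[R]_N) : dot x (y + z) = dot x y + dot x z.
Proof. by rewrite dotC dotDl !(dotC x). Qed.

Lemma dotZr N a (x y : 'rV[R]_N) : dot x (a *: y) = a * dot x y.
Proof. by rewrite dotC dotZl dotC. Qed.

Lemma dot_suml N (I : finType) (F : I -> 'rV[R]_N) y :
  dot (\sum_i F i) y = \sum_i dot (F i) y.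
Proof. by rewrite /dot mulmx_suml summxE. Qed.

Lemma dot_ge0 N (x : 'rV[R]_N) : 0 <= dot x x.
Proof. by rewrite dotE sumr_ge0// => i _; rewrite -expr2 sqr_ge0. Qed.

Lemma dot_eq0 N (x : 'rV[R]_N) : dot x x = 0 -> x = 0.
Proof.
rewrite dotE => /eqP; rewrite psumr_eq0 => [/allP x0|i _]; last first.
  by rewrite -expr2 sqr_ge0.
apply/rowP => i; rewrite mxE; apply/eqP.
by have /(_ i) := x0; rewrite mem_index_enum mulf_eq0 orbb => /(_ isT).
Qed.

(** * The standard simplex and nearest points of convex hulls *)

Definition simplex n : set 'rV[R]_n :=
  [set l | (forall i, 0 <= l 0 i) /\ \sum_i l 0 i = 1].
Arguments simplex : clear implicits.

Lemma continuous_sumr (T : topologicalType) (I : finType) (F : I -> T -> R) :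
  (forall i, continuous (F i)) -> continuous (fun x => \sum_i F i x).
Proof.
move=> cF x; elim: (index_enum I) => [|i s IHs].
  under eq_fun do rewrite big_nil; exact: cvg_cst.
under eq_fun do rewrite big_cons.
by apply: cvgD; [exact: cF|exact: IHs].
Qed.

Lemma simplex_compact n : compact (simplex n).
Proof.
have /subclosed_compact : compact
    [set v : 'rV[R]_n | forall i, (`[0%R, 1%R] : set R) (v ord0 i)].
  by apply: (@rV_compact R n (fun=> `[0%R, 1%R])) => i; exact: segment_compact.
apply; last first.
  move=> l [l0 l1] i /=; rewrite in_itv/= l0/= -l1 (bigD1 i)//= lerDl.
  by rewrite sumr_ge0.
have -> : simplex n = (\bigcap_i [set l | 0 <= l 0 i]) `&`
                       [set l | \sum_i l 0 i = 1].
  by apply/seteqP; split => l [l0 l1]; split => // i; [move=> _; exact: l0|exact: l0].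
apply: closedI.
  apply: closed_bigI => i _.
  apply: (@preimage_closed _ _ (fun l : 'rV[R]_n => l 0 i) [set x | 0 <= x]).
    by move=> l _; exact: coord_continuous.
  exact: closed_ge.
apply: (@preimage_closed _ _ (fun l : 'rV[R]_n => \sum_i l 0 i) [set x | x = 1]).
  by move=> l _; apply: continuous_sumr => i; exact: coord_continuous.
exact: closed_eq.
Qed.

Lemma simplex_delta n i : simplex n (delta_mx 0 i).
Proof.
split=> [j|]; first by rewrite mxE.
rewrite (bigD1 i)//= big1 ?addr0; first by rewrite mxE !eqxx.
by move=> j ji; rewrite mxE (negPf ji) andbF.
Qed.

Definition comb n N (w : 'I_n -> 'rV[R]_N) (l : 'rV[R]_n) : 'rV[R]_N :=
  \sum_i l 0 i *: w i.

Lemma comb_min n N (w : 'I_n.+1 -> 'rV[R]_N) : exists2 l, simplex n.+1 l &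
  forall t, simplex n.+1 t -> dot (comb w l) (comb w l) <= dot (comb w t) (comb w t).
Proof.
have [||l /set_mem ls lmin] := @compact_EVT_min _ R
    (fun l => dot (comb w l) (comb w l)) _ _ (@simplex_compact n.+1).
- by exists (delta_mx 0 0); exact: simplex_delta.
- apply: continuous_subspaceT.
  have cb b : continuous (fun l => comb w l 0 b).
    have -> : (fun l => comb w l 0 b) = (fun l => \sum_i l 0 i * w i 0 b).
      by apply/funext => l; rewrite /comb summxE; apply: eq_bigr => i _; rewrite mxE.
    apply: continuous_sumr => i l; apply: continuousM;
      [exact: coord_continuous|exact: cst_continuous].
  under eq_fun do rewrite dotE.
  by apply: continuous_sumr => b l; apply: continuousM; exact: cb.
- by exists l => // t ts; apply: lmin; exact: mem_set.
Qed.

Lemma combD n N (w : 'I_n -> 'rV[R]_N) l t : comb w (l + t) = comb w l + comb w t.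
Proof.
by rewrite /comb -big_split; apply: eq_bigr => i _; rewrite mxE scalerDl.
Qed.

Lemma combZ n N (w : 'I_n -> 'rV[R]_N) a l : comb w (a *: l) = a *: comb w l.
Proof.
by rewrite /comb scaler_sumr; apply: eq_bigr => i _; rewrite mxE scalerA.
Qed.

Lemma comb_delta n N (w : 'I_n -> 'rV[R]_N) i : comb w (delta_mx 0 i) = w i.
Proof.
rewrite /comb (bigD1 i)//= big1 ?addr0; first by rewrite mxE !eqxx scale1r.
by move=> j ji; rewrite mxE (negPf ji) andbF scale0r.
Qed.

Lemma simplex_convex n l t (s : R) : 0 <= s <= 1 ->
  simplex n l -> simplex n t -> simplex n ((1 - s) *: l + s *: t).
Proof.
move=> /andP[s0 s1] [l0 l1] [t0 t1]; split=> [i|].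
  by rewrite !mxE addr_ge0 ?mulr_ge0 ?subr_ge0.
under eq_bigr do rewrite !mxE.
by rewrite big_split/= -!mulr_sumr l1 t1 !mulr1 subrK.
Qed.

(** First-order condition at a nearest point [p]: a vertex [w i] violating the bound would let [p]
    move towards it and get shorter. *)
Lemma comb_min_dot n N (w : 'I_n -> 'rV[R]_N) l : simplex n l ->
  (forall t, simplex n t -> dot (comb w l) (comb w l) <= dot (comb w t) (comb w t)) ->
  forall i, dot (comb w l) (comb w l) <= dot (w i) (comb w l).
Proof.
move=> ls lmin i; set p := comb w l.
rewrite leNgt; apply/negP => lt_wp.
pose d := dot p p - dot (w i) p; have d0 : 0 < d by rewrite subr_gt0.
pose e := dot (w i - p) (w i - p); have e0 : 0 <= e by exact: dot_ge0.
(* The squared norm changes by [s * (s * e - 2 * d)]; dividing by [d + e] secures both [s <= 1] and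
   [s * e <= d]. *)
pose s := d / (d + e).
have de0 : 0 < d + e by rewrite ltr_wpDr.
have s0 : 0 < s by rewrite divr_gt0.
have s1 : s <= 1 by rewrite ler_pdivrMr// mul1r lerDl.
have s01 : 0 <= s <= 1 by rewrite ltW.
have := lmin _ (simplex_convex s01 ls (@simplex_delta n i)).
rewrite combD !combZ comb_delta -/p.
have -> : (1 - s) *: p + s *: w i = p + s *: (w i - p).
  by rewrite scalerBl scale1r scalerBr addrA addrAC.
have -> : dot (p + s *: (w i - p)) (p + s *: (w i - p)) =
          dot p p + s * (s * e - 2 * d).
  have dX : dot (w i - p) p = - d by rewrite dotDl -scaleN1r dotZl mulN1r /d opprB.
  rewrite dotDl dotZl !dotDr !dotZr -/e.
  by rewrite [dot p (w i - p)]dotC dX; ring.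
rewrite lerDl pmulr_rge0// subr_ge0 => le_d.
have : s * e < 2 * d.
  apply: (@le_lt_trans _ _ d); last by lra.
  by rewrite /s mulrAC ler_pdivrMr// ler_pM2l// lerDr ltW.
by rewrite ltNge le_d.
Qed.

(* Moving along an affine dependency of the [w i] until a coefficient vanishes. *)
Lemma simplex_facet n N (w : 'I_n -> 'rV[R]_N) l (mu : 'rV_n) : simplex n l ->
  mu != 0 -> \sum_i mu 0 i = 0 -> comb w mu = 0 ->
  exists t, [/\ simplex n t, comb w t = comb w l & exists i, t 0 i = 0].
Proof.
move=> [l0 l1] mu_neq0 mu0 wmu0.
have [i0 i0neg] : exists i, mu 0 i < 0.
  apply/not_existsP => mu_ge0; move/eqP: mu_neq0; apply; apply/rowP => i.
  have mu_ge j : 0 <= mu 0 j by rewrite leNgt; apply/negP/mu_ge0.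
  move/eqP: mu0; rewrite psumr_eq0// => /allP/(_ i).
  by rewrite mem_index_enum mxE => /(_ isT)/eqP.
(* The smallest ratio singles out the coefficient that vanishes first along [mu], the others still
   being nonnegative. *)
have [i ineg imin] := @arg_minP _ R _ i0 (fun i => mu 0 i < 0)
  (fun i => l 0 i / - mu 0 i) i0neg.
pose s := l 0 i / - mu 0 i.
have s0 : 0 <= s by rewrite divr_ge0// oppr_ge0 ltW.
exists (l + s *: mu); split.
- split=> [j|].
    rewrite !mxE; have [mj|mj] := leP 0 (mu 0 j).
      by rewrite addr_ge0// mulr_ge0.
    have := imin _ mj; rewrite ler_pdivlMr ?oppr_gt0//; rewrite -/s; lra.
  under eq_bigr do rewrite !mxE.
  by rewrite big_split/= -mulr_sumr l1 mu0 mulr0 addr0.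
- by rewrite combD combZ wmu0 scaler0 addr0.
- exists i; rewrite !mxE /s invrN mulrN mulNr mulfVK ?subrr//.
  by rewrite lt_eqF.
Qed.

(* Barany's argument: a rainbow simplex at minimal distance from the origin,
   when it misses the origin, has its nearest point on a facet, and the vertex
   opposite to that facet can be recoloured to get strictly closer. *)
Lemma colorful_caratheodory N k (u : 'I_N.+1 -> 'I_k.+1 -> 'rV[R]_N) :
  (forall i, \sum_j u i j = 0) ->
  exists (f : 'I_N.+1 -> 'I_k.+1) l,
    simplex N.+1 l /\ comb (fun i => u i (f i)) l = 0.
Proof.
move=> u0.
pose w (f : {ffun 'I_N.+1 -> 'I_k.+1}) i := u i (f i).
have /choice[L HL] : forall f, exists l, simplex N.+1 l /\ forall t,
    simplex N.+1 t -> dot (comb (w f) l) (comb (w f) l) <= dot (comb (w f) t) (comb (w f) t).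
  by move=> f; have [l ls lmin] := comb_min (w f); exists l.
have [f _ fmin] := @arg_minP _ R _ [ffun=> 0] predT
  (fun f => dot (comb (w f) (L f)) (comb (w f) (L f))) isT.
have {}fmin g t : simplex N.+1 t ->
    dot (comb (w f) (L f)) (comb (w f) (L f)) <= dot (comb (w g) t) (comb (w g) t).
  by move=> ts; apply: (le_trans (fmin g isT)); exact: (HL g).2.
have [ls _] := HL f.
move: (L f) ls fmin => l ls fmin {L HL}.
exists f, l; split => //; rewrite -/(w f); set p := comb _ _.
apply: contrapT => /eqP p_neq0.
have p0 : 0 < dot p p.
  rewrite lt_neqAle dot_ge0 andbT eq_sym; apply: contra_neq p_neq0.
  exact: dot_eq0.
have wp := comb_min_dot ls (fmin f).
have [t [ts tp [i ti0]]] : exists t,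
    [/\ simplex N.+1 t, comb (w f) t = p & exists i, t 0 i = 0].
  have [[i li0]|lN0] := pselect (exists i, l 0 i = 0); first by exists l; split => //; exists i.
  (* The inequalities [wp] average to an equality with weights [l], none of which is zero, so each
     of them is an equality. *)
  have wpE i : dot (w f i) p = dot p p.
    have : \sum_i l 0 i * (dot (w f i) p - dot p p) = 0.
      under eq_bigr do rewrite mulrBr.
      rewrite sumrB -mulr_suml ls.2 mul1r {2}/p /comb dot_suml.
      by under [X in _ - X]eq_bigr do rewrite dotZl; rewrite subrr.
    move=> /eqP; rewrite psumr_eq0 => [/allP/(_ i)|j _]; last first.
      by rewrite mulr_ge0 ?ls.1// subr_ge0; exact: wp.
    rewrite mem_index_enum mulf_eq0 subr_eq0 => /(_ isT)/orP[/eqP li0|/eqP//].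
    by case: lN0; exists i.
  (* [N + 1] vectors in dimension [N] are dependent; pairing the relation with [p] shows that its
     coefficients sum to [0]. *)
  pose W := \matrix_i w f i.
  have : kermx W != 0.
    by rewrite kermx_eq0 -row_leq_rank -ltnNge ltnS rank_leq_col.
  move=> /rowV0Pn[mu /sub_kermxP muW mu_neq0].
  have wmu0 : comb (w f) mu = 0.
    rewrite -muW mulmx_sum_row; apply: eq_bigr => i _.
    by rewrite rowK.
  apply: (simplex_facet ls mu_neq0 _ wmu0).
  have : dot (comb (w f) mu) p = 0 by rewrite wmu0 /dot mul0mx mxE.
  rewrite /comb dot_suml; under eq_bigr do rewrite dotZl wpE.
  by rewrite -mulr_suml => /eqP; rewrite mulf_eq0 (gt_eqF p0) orbF => /eqP.
have [j uj] : exists j, dot (u i j) p <= 0.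
  apply/not_existsP => uN.
  have : dot (\sum_j u i j) p = 0 by rewrite u0 /dot mul0mx mxE.
  rewrite dot_suml => /eqP; rewrite psumr_eq0 => [/allP/(_ 0)|j _].
    rewrite mem_index_enum => /(_ isT)/eqP u00.
    by apply: (uN 0); rewrite u00.
  by rewrite leNgt; apply/negP => /ltW /uN.
(* As [t 0 i = 0], the recoloured simplex still has [p] as a nearest point, so all its vertices pair
   with [p] to at least [dot p p > 0]; the new vertex does not. *)
pose g := [ffun i' => if i' == i then j else f i'].
have gp : comb (w g) t = p.
  rewrite -tp /comb; apply: eq_bigr => i' _; rewrite /w ffunE.
  by case: eqP => // ->; rewrite ti0 !scale0r.
have := @comb_min_dot _ _ (w g) _ ts; rewrite gp => /(_ _ i) /=.
rewrite /w ffunE eqxx => /(_ _)/le_trans/(_ uj); rewrite leNgt p0.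
by move=> H; apply/notF/H => s ss; exact: fmin.
Qed.

(* Sarkaria's trick: the [b]-th coordinate of the colour [j] is
   [(j == b + 1) - (j == 0)], so the colours span a [k]-space with the single
   relation that they sum to [0]. *)
Lemma tverberg m k (x : 'I_(m.+1 * k).+1 -> 'rV[R]_m) :
  exists (f : 'I_(m.+1 * k).+1 -> 'I_k.+1) (l : 'I_(m.+1 * k).+1 -> R) (a : 'rV[R]_m),
    (forall i, 0 <= l i) /\
    forall j, \sum_(i | f i == j) l i = 1 /\ \sum_(i | f i == j) l i *: x i = a.
Proof.
(* The leading [1] lets equality of the block sums include equality of the block weights. *)
pose xb i : 'rV[R]_(1 + m) := row_mx 1 (x i).
pose v (j : 'I_k.+1) (b : 'I_k) : R := (j == lift ord0 b)%:R - (j == ord0)%:R.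
pose M i j : 'M[R]_(1 + m, k) := \matrix_(a, b) (xb i 0 a * v j b).
have [i|f [l [[l0 l1] lu]]] := @colorful_caratheodory _ k (fun i j => mxvec (M i j)).
  rewrite -raddf_sum -[RHS](linear0 mxvec) /=; congr mxvec.
  apply/matrixP => a b; rewrite summxE mxE.
  under eq_bigr do rewrite mxE.
  rewrite -mulr_sumr /v sumrB.
  rewrite (bigD1 (lift ord0 b))//= eqxx [X in _ + X - _]big1 => [|j /negPf->//].
  rewrite (bigD1 ord0)//= [X in _ - (_ + X)]big1 => [|j /negPf->//].
  by rewrite subrr mulr0.
have ME a b : \sum_i l 0 i * (xb i 0 a * v (f i) b) = 0.
  have : \sum_i l 0 i *: M i (f i) = 0.
    apply: (can_inj (@mxvecK _ _ _)); rewrite linear0 raddf_sum -[RHS]lu /comb.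
    by apply: eq_bigr => i _; rewrite /= linearZ.
  move=> /matrixP/(_ a b); rewrite summxE mxE => E; rewrite -[RHS]E.
  by apply: eq_bigr => i _; rewrite !mxE.
have scE i a : (l 0 i *: xb i) 0 a = l 0 i * xb i 0 a by rewrite mxE.
pose S j := \sum_(i | f i == j) l 0 i *: xb i.
(* Coordinate [b] of the vanishing combination compares block [b + 1] with block [0]. *)
have SE j : S j = S ord0.
  have [->//|jN0] := eqVneq j ord0.
  have [b jE|jE] := unliftP ord0 j; last by rewrite jE eqxx in jN0.
  apply/rowP => a; have /eqP := ME a b; rewrite /v jE.
  under eq_bigr do rewrite mulrBr mulrBr.
  rewrite sumrB subr_eq0 => /eqP E; rewrite /S !summxE.
  rewrite [LHS]big_mkcond [RHS]big_mkcond/=.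
  rewrite (eq_bigr (fun i => l 0 i * (xb i 0 a * (f i == lift ord0 b)%:R))).
    rewrite E; apply: eq_bigr => i _; rewrite scE.
    by case: eqP => _; rewrite ?mulr1 ?mulr0.
  by move=> i _; rewrite scE; case: eqP => _; rewrite ?mulr1 ?mulr0.
have lS j : \sum_(i | f i == j) l 0 i = S j 0 (lshift m ord0).
  rewrite /S summxE; apply: eq_bigr => i _.
  by rewrite scE row_mxEl mxE mulr1.
have k0 : k.+1%:R != 0 :> R by rewrite pnatr_eq0.
have lk j : k.+1%:R * \sum_(i | f i == j) l 0 i = 1.
  rewrite -[RHS]l1 [RHS](partition_big f predT)//= mulr_natl.
  rewrite [RHS](eq_bigr (fun=> \sum_(i | f i == j) l 0 i)).
    by rewrite sumr_const card_ord.
  by move=> j' _; rewrite !lS !SE.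
(* The [k + 1] blocks share the total weight [1] equally, hence the rescaling. *)
exists f, (fun i => k.+1%:R * l 0 i), (k.+1%:R *: rsubmx (S ord0)); split.
  by move=> i; rewrite mulr_ge0.
move=> j; split; first by rewrite -mulr_sumr.
rewrite -(SE j) /S raddf_sum scaler_sumr; apply: eq_bigr => i _.
by rewrite /= linearZ/= row_mxKr scalerA.
Qed.

End Tverberg.

(** * Joint rank-k numerical ranges *)

Section JointNumericalRange.
Context {R : realType} {V : lmodType R[i]} {ip : V -> V -> R[i]}.
Hypothesis ipH : is_hilbert ip.
Local Notation cR := (real_complex R).

(** * Sesquilinearity of the inner product and linearity of operators *)

Lemma ipDl x y z : ip (x + y) z = ip x z + ip y z.
Proof. by rewrite -[x]scale1r (ip_linl ipH) mul1r scale1r. Qed.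

Lemma ip0l z : ip 0 z = 0.
Proof. by apply: (addrI (ip 0 z)); rewrite -ipDl !addr0. Qed.

Lemma ipZl a x z : ip (a *: x) z = a * ip x z.
Proof. by rewrite -[a *: x]addr0 (ip_linl ipH) ip0l addr0. Qed.

Lemma ip_suml (I : finType) (P : pred I) (c : I -> R[i]) (e : I -> V) z :
  ip (\sum_(i | P i) c i *: e i) z = \sum_(i | P i) c i * ip (e i) z.
Proof.
elim/big_rec2: _ => [|i a x _ <-]; first exact: ip0l.
by rewrite ipDl ipZl.
Qed.

Lemma ipDr x y z : ip x (y + z) = ip x y + ip x z.
Proof. by rewrite !(ip_conj ipH _ x) ipDl rmorphD. Qed.

Lemma ipZr a x z : ip x (a *: z) = conjc a * ip x z.
Proof. by rewrite !(ip_conj ipH _ x) ipZl rmorphM. Qed.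

Lemma ip_sumr (I : finType) (P : pred I) (c : I -> R[i]) (e : I -> V) z :
  ip z (\sum_(i | P i) c i *: e i) = \sum_(i | P i) conjc (c i) * ip z (e i).
Proof.
rewrite (ip_conj ipH) ip_suml rmorph_sum; apply: eq_bigr => i _.
by rewrite rmorphM (ip_conj ipH _ z).
Qed.

Lemma ip_eq0C x y : ip x y = 0 -> ip y x = 0.
Proof. by move=> xy0; rewrite (ip_conj ipH x) xy0 conjc0. Qed.

Lemma linear_op0 (T : V -> V) : is_linear_op T -> T 0 = 0.
Proof.
by move=> lT; apply: (addrI (T 0)); rewrite -{2}[T 0]scale1r addrC -lT scaler0 !addr0.
Qed.

Lemma linear_op_sum (T : V -> V) (I : finType) (P : pred I) (c : I -> R[i]) e :
  is_linear_op T ->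
  T (\sum_(i | P i) c i *: e i) = \sum_(i | P i) c i *: T (e i).
Proof.
move=> lT; elim/big_rec2: _ => [|i x y _ <-]; first exact: linear_op0.
exact: lT.
Qed.

(** * Spans, unit vectors and greedy selection *)

Definition in_span n (e : 'I_n -> V) (x : V) : Prop :=
  exists c : 'I_n -> R[i], x = \sum_i c i *: e i.

Definition independent n (e : 'I_n -> V) : Prop :=
  forall c : 'I_n -> R[i], \sum_i c i *: e i = 0 -> forall i, c i = 0.

Lemma in_span_ip n (e : 'I_n -> V) x y z : in_span e x ->
  (forall i, ip y (e i) = ip z (e i)) -> ip y x = ip z x.
Proof.
move=> [c ->] yz; rewrite !ip_sumr; apply: eq_bigr => i _.
by rewrite yz.
Qed.

Lemma orthonormal_independent n (e : 'I_n -> V) :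
  Defs.orthonormal ip e -> independent e.
Proof.
move=> oe c c0 i; have : ip (\sum_i c i *: e i) (e i) = 0 by rewrite c0 ip0l.
rewrite ip_suml (bigD1 i)//= oe eqxx mulr1 big1 ?addr0// => j /negPf ji.
by rewrite oe ji mulr0.
Qed.

Lemma exists_unit x : x <> 0 -> exists2 a, a != 0 & ip (a *: x) (a *: x) = 1.
Proof.
move=> x0; have [i0 r0] := ip_ge0 ipH x.
have xE : ip x x = cR (complex.Re (ip x x)).
  by apply/eqP; rewrite eq_complex /= i0 !eqxx.
set r := complex.Re _ in r0 xE.
have {}r0 : 0 < r.
  rewrite lt_neqAle r0 andbT eq_sym; apply/eqP => r_eq0; apply: x0.
  by apply: (ip_def ipH); rewrite xE r_eq0.
have s0 : Num.sqrt r != 0 by rewrite gt_eqF ?sqrtr_gt0.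
exists (cR (Num.sqrt r)^-1).
  by rewrite fmorph_eq0 invr_eq0.
rewrite ipZl ipZr conjc_real xE -!rmorphM/= -[RHS](rmorph1 cR); congr (cR _).
by rewrite -{3}(sqr_sqrtr (ltW r0)); field.
Qed.

(** [size s] homogeneous linear equations in more than [size s] coefficients have a nonzero
    solution, which is then normalised. *)
Lemma unit_orthogonal n (e : 'I_n -> V) (s : seq V) :
  independent e -> (size s < n)%N ->
  exists x, [/\ in_span e x, ip x x = 1 & forall w, w \in s -> ip x w = 0].
Proof.
move=> ie sn.
pose M := \matrix_(i < n, r < size s) ip (e i) s`_r.
have : kermx M != 0.
  by rewrite kermx_eq0 -row_leq_rank -ltnNge (leq_ltn_trans (rank_leq_col _)).
move=> /rowV0Pn[c /sub_kermxP cM c0].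
pose x := \sum_i c 0 i *: e i.
have x0 : x <> 0.
  move=> /(ie (c 0)) ci0; move/eqP: c0; apply; apply/rowP => i.
  by rewrite ci0 mxE.
have [a a0 ax] := exists_unit x0.
exists (a *: x); split=> //.
  exists (fun i => a * c 0 i); rewrite scaler_sumr.
  by apply: eq_bigr => i _; rewrite scalerA.
move=> w ws; rewrite ipZl; apply/eqP; rewrite mulf_eq0; apply/orP; right.
have iw : (index w s < size s)%N by rewrite index_mem.
move/matrixP: cM => /(_ 0 (Ordinal iw)); rewrite !mxE => cM.
apply/eqP; rewrite -[RHS]cM ip_suml; apply: eq_bigr => i _.
by rewrite mxE /= nth_index.
Qed.

Lemma size_flatten_le (T S : Type) (F : T -> seq S) d (s : seq T) :
  (forall v, size (F v) <= d)%N -> (size (flatten (map F s)) <= size s * d)%N.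
Proof.
move=> Fd; elim: s => //= x s IHs.
by rewrite size_cat mulSn leq_add.
Qed.

(** The choice of [y i] has to meet the conditions from [s] and from [F (y r)] for at most [q - 1]
    earlier [r], fewer than [n] in all. Orthogonality is recorded only from later to earlier
    vectors; symmetry supplies the converse where it is wanted. *)
Lemma greedy_units n (e : 'I_n -> V) (F : V -> seq V) d (s : seq V) q :
  independent e -> (forall v, size (F v) <= d)%N -> (size s + q.-1 * d < n)%N ->
  exists y : nat -> V, forall i, (i < q)%N ->
    [/\ in_span e (y i), ip (y i) (y i) = 1,
        forall w, w \in s -> ip (y i) w = 0 &
        forall r, (r < i)%N -> forall w, w \in F (y r) -> ip (y i) w = 0].
Proof.
move=> ie Fd; elim: q => [_|q IHq sn]; first by exists (fun=> 0).
have [|y yP] := IHq.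
  by apply: leq_ltn_trans sn; rewrite leq_add2l leq_mul2r leq_pred orbT.
pose s' := s ++ flatten [seq F (y r) | r <- iota 0 q].
have [|x [xe xx xs]] := @unit_orthogonal n e s' ie.
  apply: leq_ltn_trans sn; rewrite size_cat leq_add2l.
  rewrite -[X in (_ <= X * d)%N](size_iota 0 q).
  by apply: (@size_flatten_le _ _ (fun r => F (y r))).
exists (fun i => if i == q then x else y i) => i; rewrite ltnS leq_eqVlt.
have [-> _|iq /= {}iq] := eqVneq i q.
  split=> // [w ws|r rq w]; first by apply: xs; rewrite mem_cat ws.
  rewrite (ltn_eqF rq) => wF; apply: xs; rewrite mem_cat; apply/orP; right.
  by apply/flatten_mapP; exists r => //; rewrite mem_iota.
have [ye yy ys yF] := yP i iq; split=> // r ri.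
by rewrite (ltn_eqF (ltn_trans ri iq)); exact: yF.
Qed.

Lemma orthonormal_ltn q (y : nat -> V) :
  (forall i, (i < q)%N -> ip (y i) (y i) = 1) ->
  (forall i r, (i < q)%N -> (r < i)%N -> ip (y i) (y r) = 0) ->
  Defs.orthonormal ip (fun i : 'I_q => y i).
Proof.
move=> y1 y0 i j; rewrite -val_eqE /=.
have [ij|ji|->] := ltngtP (i : nat) j; last by rewrite y1.
- by apply: ip_eq0C; rewrite y0.
- by rewrite y0.
Qed.

Lemma exists_orthonormal n q : dim_ge V n -> (q <= n)%N ->
  exists e : 'I_q -> V, Defs.orthonormal ip e.
Proof.
case: q => [_ _|q [e ie] qn]; first by exists (fun=> 0) => -[].
have [||y yP] := @greedy_units n e (fun v => [:: v]) 1 [::] q.+1 ie => //.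
  by rewrite /= muln1.
exists (fun i : 'I_q.+1 => y i); apply: orthonormal_ltn => [i iq|i r iq ri].
  by have [] := yP i iq.
by have [_ _ _ /(_ r ri)] := yP i iq; apply; rewrite inE.
Qed.

(** The compression of [T] to the span of [e] is a matrix over the algebraically closed field
    [R[i]]. Its eigenvector [x] need not be one of [T]: [T x] and [a *: x] agree only when tested
    against the span. *)
Lemma exists_eigenvector n (e : 'I_n -> V) (T : V -> V) :
  Defs.orthonormal ip e -> is_linear_op T -> (0 < n)%N ->
  exists x a, [/\ in_span e x, ip x x = 1 &
    forall i, ip (T x) (e i) = ip (a *: x) (e i)].
Proof.
move=> oe lT n0.
have [a /eigenvalueP[v vM v0]] :=
  eigenvalue_closed (\matrix_(i, j) ip (T (e i)) (e j)) n0.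
pose x := \sum_i v 0 i *: e i.
have x0 : x <> 0.
  move=> /(orthonormal_independent oe (c := v 0)) vi0.
  by move/eqP: v0; apply; apply/rowP => i; rewrite vi0 mxE.
have [b b0 bx] := exists_unit x0.
exists (b *: x), a; split=> // [|i].
  exists (fun i => b * v 0 i); rewrite scaler_sumr.
  by apply: eq_bigr => i _; rewrite scalerA.
have -> : T (b *: x) = b *: T x by rewrite -[b *: x]addr0 lT (linear_op0 lT) addr0.
rewrite scalerA mulrC -scalerA !(ipZl b); congr (_ * _).
move/matrixP: vM => /(_ 0 i); rewrite !mxE => vM.
rewrite /x linear_op_sum// ip_suml ipZl ip_suml (bigD1 i)//=.
rewrite [X in a * X](bigD1 i)//= oe eqxx mulr1 [X in a * (_ + X)]big1 ?addr0.
  rewrite -[RHS]vM [RHS](bigD1 i)//= mxE; congr (_ + _).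
  by apply: eq_bigr => j _; rewrite mxE.
by move=> j /negPf ji; rewrite oe ji mulr0.
Qed.

(** * Scalar compressions in terms of orthonormal frames *)

Definition compresses_to m k (A : 'I_m -> V -> V) (a : 'rV[R]_m)
    (e : 'I_k -> V) : Prop :=
  Defs.orthonormal ip e /\
  forall j i l, ip (A j (e i)) (e l) = cR (a 0 j) * (i == l)%:R.

(** Conversely to reading a frame off [P], the orthogonal projection onto the span of [e] is [x]
    mapped to the sum of the [ip x (e i) *: e i]. *)
Lemma joint_rank_k_nrP m k (A : 'I_m -> V -> V) (a : 'rV[R]_m) :
  (forall j, is_linear_op (A j)) ->
  joint_rank_k_nr ip k A a <-> exists e : 'I_k -> V, compresses_to A a e.
Proof.
move=> lA; split=> [[P [[lP PP saP [e [oe Pe _]]] PA]]|[e [oe Ae]]].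
  exists e; split=> // j i l.
  by rewrite -(Pe l) -saP -{1}(Pe i) PA ipZl Pe oe.
pose P x := \sum_i ip x (e i) *: e i.
have lP : is_linear_op P.
  move=> b x y; rewrite /P scaler_sumr -big_split; apply: eq_bigr => i _.
  by rewrite ipDl ipZl scalerDl scalerA.
have Pe i : P (e i) = e i.
  rewrite /P (bigD1 i)//= oe eqxx scale1r big1 ?addr0// => j ji.
  by rewrite oe eq_sym (negPf ji) scale0r.
have PPx x : P (P x) = P x.
  by rewrite {2}/P linear_op_sum//; apply: eq_bigr => i _; rewrite Pe.
exists P; split.
  split=> //.
    move=> x y; rewrite ip_suml ip_sumr; apply: eq_bigr => i _.
    by rewrite -(ip_conj ipH) mulrC.
  by exists e; split=> // x; exists (fun i => ip x (e i)).
move=> j x.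
have PAe i : P (A j (e i)) = cR (a 0 j) *: e i.
  rewrite /P (bigD1 i)//= Ae eqxx mulr1 big1 ?addr0// => l li.
  by rewrite Ae eq_sym (negPf li) mulr0 scale0r.
rewrite [A j _](linear_op_sum _ _ _ (lA j)) linear_op_sum// scaler_sumr; apply: eq_bigr => i _.
by rewrite PAe !scalerA mulrC.
Qed.

Lemma joint_rank_k_nr_anti m k K (A : 'I_m -> V -> V) :
  (forall j, is_linear_op (A j)) -> (k <= K)%N ->
  joint_rank_k_nr ip K A `<=` joint_rank_k_nr ip k A.
Proof.
move=> lA kK a /(joint_rank_k_nrP _ _ lA)[e [oe Ae]].
apply/(joint_rank_k_nrP _ _ lA); exists (e \o widen_ord kK).
by split=> [i l|j i l]; rewrite ?oe ?Ae -val_eqE.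
Qed.

(** The frame entries extend by sesquilinearity, so every orthonormal family inside the span of [e]
    compresses [A] to the same [a]. *)
Lemma compresses_to_span m k (A : 'I_m -> V -> V) (a : 'rV[R]_m) (e : 'I_k -> V) j x y :
  is_linear_op (A j) -> compresses_to A a e -> in_span e x -> in_span e y ->
  ip (A j x) y = cR (a 0 j) * ip x y.
Proof.
move=> lA [oe Ae] [c ->] ye; rewrite -ipZl; apply: in_span_ip ye _ => l.
rewrite linear_op_sum// ip_suml ipZl ip_suml mulr_sumr; apply: eq_bigr => i _.
by rewrite Ae oe mulrCA.
Qed.

(** * Star centres *)

Lemma star_center m k K (A : 'I_m -> V -> V) (a b : 'rV[R]_m) (t : R) :
  (forall j, is_linear_op (A j)) -> (forall j, is_selfadjoint ip (A j)) ->
  (m.+1 * k + k.-1 < K)%N -> 0 <= t <= 1 ->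
  joint_rank_k_nr ip K A a -> joint_rank_k_nr ip k A b ->
  joint_rank_k_nr ip k A ((1 - t) *: a + t *: b).
Proof.
move=> lA saA kK /andP[t0 t1].
move=> /(joint_rank_k_nrP _ _ lA)[e ce] /(joint_rank_k_nrP _ _ lA)[x [ox Ax]].
apply/joint_rank_k_nrP => //.
pose s := codom x ++ [seq A j (x i) | j <- enum 'I_m, i <- enum 'I_k].
have [||y yP] := @greedy_units K e (fun v => [:: v]) 1 s k
  (orthonormal_independent ce.1) => //.
  (* There are [k] vectors [x i], [m * k] vectors [A j (x i)] and at most [k - 1] earlier choices,
     which is the bound assumed on [K]. *)
  rewrite size_cat size_codom size_allpairs !size_enum_ord card_ord muln1.
  by move: kK; rewrite mulSn.
have oy : Defs.orthonormal ip (fun i : 'I_k => y i).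
  apply: orthonormal_ltn => [i ik|i r ik ri]; first by have [] := yP i ik.
  by have [_ _ _ /(_ r ri)] := yP i ik; apply; rewrite inE.
have ye (i : 'I_k) : in_span e (y i) by have [] := yP i (ltn_ord i).
have yx (i l : 'I_k) : ip (y i) (x l) = 0.
  have [_ _ + _] := yP i (ltn_ord i); apply.
  by rewrite mem_cat codom_f.
have yAx j (i l : 'I_k) : ip (y i) (A j (x l)) = 0.
  have [_ _ + _] := yP i (ltn_ord i); apply.
  by rewrite mem_cat; apply/orP; right; apply: allpairs_f; rewrite mem_enum.
have Ay j (i l : 'I_k) : ip (A j (y i)) (y l) = cR (a 0 j) * (i == l)%:R.
  by rewrite (compresses_to_span (lA j) ce) // oy.
pose p := cR (Num.sqrt (1 - t)); pose q := cR (Num.sqrt t).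
have pp : p * p = cR (1 - t) by rewrite -rmorphM -expr2 sqr_sqrtr ?subr_ge0.
have qq : q * q = cR t by rewrite -rmorphM -expr2 sqr_sqrtr.
(* The mixed term will vanish: [y i] is orthogonal to [x l] and to [A j (x l)], hence by
   self-adjointness [A j (y i)] is orthogonal to [x l]. *)
have ipz u v u' v' : ip (p *: u + q *: v) (p *: u' + q *: v') =
    cR (1 - t) * ip u u' + cR t * ip v v' + p * q * (ip u v' + ip v u').
  rewrite !ipDl !ipDr !ipZl !ipZr !conjc_real -/p -/q -pp -qq; ring.
exists (fun i : 'I_k => p *: y i + q *: x i); split=> [i l|j i l].
  rewrite ipz oy ox yx (ip_eq0C (yx l i)) addr0 mulr0 addr0 -mulrDl -rmorphD.
  by rewrite subrK mul1r.
have -> : A j (p *: y i + q *: x i) = p *: A j (y i) + q *: A j (x i).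
  by rewrite lA -[q *: x i]addr0 lA (linear_op0 (lA j)) addr0.
rewrite ipz Ay Ax saA yAx (ip_eq0C (yAx j l i)) addr0 mulr0 addr0.
by rewrite !mulrA -mulrDl -!rmorphM -rmorphD !mxE.
Qed.

(** * Nonemptiness of the range *)

Lemma diagonal_nonempty m k (A : 'I_m -> V -> V) (y : 'I_(m.+1 * k).+1 -> V) :
  (forall j, is_linear_op (A j)) -> (forall j, is_selfadjoint ip (A j)) ->
  Defs.orthonormal ip y -> (forall j r s, r != s -> ip (A j (y r)) (y s) = 0) ->
  exists a, joint_rank_k_nr ip k.+1 A a.
Proof.
move=> lA saA oy Ay.
(* Self-adjointness makes the diagonal entries real, so taking real parts loses nothing. *)
pose d r : 'rV[R]_m := \row_j complex.Re (ip (A j (y r)) (y r)).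
have AyE j r s : ip (A j (y r)) (y s) = cR (d r 0 j) * (r == s)%:R.
  have [<-|rs] := eqVneq r s; last by rewrite mulr0 Ay.
  rewrite mulr1 mxE; apply/eqP; rewrite eq_complex /= eqxx /=.
  have : ip (A j (y r)) (y r) = conjc (ip (A j (y r)) (y r)).
    by rewrite -(ip_conj ipH) saA.
  by case: (ip _ _) => u v [] /= vE; apply/eqP; lra.
have [f [l [a [l0 la]]]] := tverberg d.
exists a; apply/joint_rank_k_nrP => //.
pose c r := cR (Num.sqrt (l r)).
have cc r : c r * c r = cR (l r) by rewrite -rmorphM -expr2 sqr_sqrtr.
have cJ r : conjc (c r) = c r by exact: conjc_real.
(* Disjoint blocks give orthogonal sums; within a block the square roots restore the weights [l r].
   Taking [g = 1] yields orthonormality, and [g r = d r 0 j] the compression. *)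
have ipz (h : 'I_(m.+1 * k).+1 -> V) (g : 'I_(m.+1 * k).+1 -> R) i i' :
    (forall r s, ip (h r) (y s) = cR (g r) * (r == s)%:R) ->
    ip (\sum_(r | f r == i) c r *: h r) (\sum_(r | f r == i') c r *: y r) =
    cR (\sum_(r | f r == i) l r * g r) * (i == i')%:R.
  move=> hy; rewrite ip_suml rmorph_sum mulr_suml; apply: eq_bigr => r /eqP ri.
  rewrite ip_sumr; under [X in _ * X = _]eq_bigr do rewrite cJ hy.
  rewrite rmorphM /= -cc.
  have [ii'|ii'] := eqVneq i i'.
    rewrite (bigD1 r) ?ri ?ii'// eqxx big1 => [|s /andP[_ /negPf sr]].
      by rewrite /= addr0 !mulr1 mulrA.
    by rewrite eq_sym sr !mulr0.
  rewrite big1 ?mulr0// => s /eqP si'.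
  case: eqP => [rs|_]; last by rewrite !mulr0.
  by rewrite -ri -si' rs eqxx in ii'.
exists (fun i => \sum_(r | f r == i) c r *: y r); split=> [i i'|j i i'].
  rewrite (ipz _ (fun=> 1)) => [|r s]; last by rewrite oy mul1r.
  under eq_bigr do rewrite mulr1.
  by rewrite (la i).1 mul1r.
rewrite linear_op_sum// (ipz _ (fun r => d r 0 j)) => [|r s]; last exact: AyE.
congr (cR _ * _); rewrite -(la i).2 summxE.
by apply: eq_bigr => r _; rewrite [RHS]mxE.
Qed.

(* The eigenvector chosen first saves the one dimension by which the plain
   greedy construction would miss the bound. *)
Lemma joint_rank_k_nr_nonempty m k (A : 'I_m.+1 -> V -> V) :
  (forall j, is_linear_op (A j)) -> (forall j, is_selfadjoint ip (A j)) ->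
  (0 < k)%N -> dim_ge V (m.+2 ^ 2 * k) ->
  exists a, joint_rank_k_nr ip k.+1 A a.
Proof.
move=> lA saA k0 Vn.
have [e oe] := exists_orthonormal Vn (leqnn _).
have [||x [a [xe xx Tx]]] := @exists_eigenvector _ e (A ord0) oe => //.
  by rewrite muln_gt0 expn_gt0.
(* [A ord0 x] is left out: against the span of [e] it behaves like [a *: x], so orthogonality to [x]
   suffices. *)
pose s := x :: [seq A (lift ord0 j) x | j <- enum 'I_m].
pose F v := v :: [seq A j v | j <- enum 'I_m.+1].
have [||y yP] := @greedy_units _ e F m.+2 s (m.+2 * k)
  (orthonormal_independent oe).
- by move=> v; rewrite /= size_map size_enum_ord.
(* The conditions number [m.+1 + (m.+2 * k - 1) * m.+2 = m.+2 ^ 2 * k - 1], one below the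
   dimension. *)
- rewrite /= size_map size_enum_ord.
  have : (0 < m.+2 * k)%N by rewrite muln_gt0.
  by move: (m.+2 * k)%N (mulnA m.+2 m.+2 k) => q; rewrite -mulnn; nia.
(* Prepending [x] to the [m.+2 * k] greedy vectors gives the number of points required by Tverberg's
   theorem. *)
pose z i := if i is i'.+1 then y i' else x.
have zF i r : (i < (m.+2 * k).+1)%N -> (r < i)%N ->
    ip (z i) (z r) = 0 /\ forall j, ip (z i) (A j (z r)) = 0.
  case: i => // i; rewrite ltnS => iq; have [ye _ ys yF] := yP i iq.
  case: r => [_|r ri] /=; last first.
    split=> [|j]; apply: (yF r ri); first by rewrite inE eqxx.
    by rewrite inE; apply/orP; right; apply: map_f; rewrite mem_enum.
  have yx0 : ip (y i) x = 0 by apply: ys; rewrite inE eqxx.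
  split=> // j; have [j' ->|->] := unliftP ord0 j.
    by apply: ys; rewrite inE; apply/orP; right; apply: map_f; rewrite mem_enum.
  apply: ip_eq0C; rewrite (in_span_ip ye Tx) ipZl.
  by rewrite (ip_eq0C yx0) mulr0.
apply: (@diagonal_nonempty _ k A (fun i : 'I__ => z i)) => //.
  apply: orthonormal_ltn => [[|i] iq //=|i r iq ri].
    by have [] := yP i iq.
  by have [] := zF i r iq ri.
move=> j r r'; rewrite -val_eqE neq_ltn => /orP[lt_rr'|lt_r'r].
  by apply: ip_eq0C; have [_] := zF r' r (ltn_ord r') lt_rr'; apply.
by rewrite saA; have [_] := zF r r' (ltn_ord r) lt_r'r; apply.
Qed.

End JointNumericalRange.

(** * Passage to the closure and conclusion *)

Lemma star_shaped_closure (R : realType) m (S : set 'rV[R]_m) :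
  star_shaped S -> star_shaped (closure S).
Proof.
move=> [c Sc starS]; exists c; first exact: subset_closure.
move=> b Sb t t01 B.
(* This homothety centred at [c] is continuous and maps [S] into itself, hence also its closure. *)
pose g (x : 'rV[R]_m) := (1 - t) *: c + t *: x.
have cg : {for b, continuous g}.
  by apply: continuousD; [exact: cst_continuous|exact: scaler_continuous].
move=> /cg /Sb[x [Sx gx]]; exists (g x); split=> //.
exact: starS.
Qed.

Theorem theorem3p4 (R : realType) (V : lmodType R[i]) (ip : V -> V -> R[i])
  (m k : nat) (A : 'I_m -> V -> V) :
  is_hilbert ip -> (0 < k)%N ->
  (forall j : 'I_m, is_bounded_op ip (A j) /\ is_selfadjoint ip (A j)) ->
  dim_ge V (((m + 2) * k - 1) * (m + 1) ^ 2)%N ->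
  star_shaped (joint_rank_k_nr ip k A) /\
  star_shaped (closure (joint_rank_k_nr ip k A)).
Proof.
move=> ipH k0 AP Vn.
have lA j : is_linear_op (A j) by have [[]] := AP j.
have saA j : is_selfadjoint ip (A j) by have [] := AP j.
suff starS : star_shaped (joint_rank_k_nr ip k A).
  by split=> //; exact: star_shaped_closure.
(* The eigenvector argument needs at least one operator. With none, any orthonormal [k]-family will
   do, and [2 * k - 1 >= k]. *)
case: m A AP Vn lA saA => [|m] A AP Vn lA saA.
  have [|e oe] := exists_orthonormal ipH (q := k) Vn; first by rewrite add0n muln1; lia.
  have S a : joint_rank_k_nr ip k A a.
    by apply/(joint_rank_k_nrP ipH) => //; exists e; split=> // -[].
  by exists 0 => // b _ t _; exact: S.
(* The rank obtained is the successor of this argument, namely [K = (m.+1 + 2) * k]. *)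
have [||c Sc] := joint_rank_k_nr_nonempty ipH (k := (m.+1 + 2) * k - 1) lA saA.
- nia.
- by rewrite mulnC -(addn1 m.+1).
have Sck : joint_rank_k_nr ip k A c.
  by apply: joint_rank_k_nr_anti Sc => //; nia.
exists c => // b Sb t t01.
(* The required inequality is tight: [m.+2 * k + k.-1 = K - 1]. *)
apply: (star_center ipH lA saA _ t01 Sc Sb); nia.
Qed.
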